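(* Let $G\subset \mathrm{GL}(n)$ be a matrix Lie group with Lie algebra $\mathfrak g\subset\mathbb R^{n\times n}$, and let $(g(t),\xi(t))\in G\times\mathfrak g$, $0\le t<\infty$, be an arbitrary trajectory of $\dot g=g\xi$. Assume: (1) $A(t)=F g(t)$ for all $t\ge 0$, where $F\in\mathbb R^{n\times n}$ is a constant invertible matrix; (2) $\xi_{\rm m}(t)=\xi(t)+b$ for all $t\ge0$, where $b\in\mathfrak g$ is constant; (3) there are constants $B_\xi>0$, $B_b>0$ with $\|\xi(t)\|\le B_\xi$ for all $t\ge 0$ and $\|b\|\le B_b$, and there are numbers $L_g>0$, $U_g>0$ with $L_g\le\sigma_{\min}(g(t))\le\sigma_{\max}(g(t))\le U_g$ for all $t\ge0$. Let $k_P>B_\xi+B_b$ and $k_I>0$, and consider the observer with state $(\bar A,\bar b)\in\mathbb R^{n\times n}\times\mathfrak g$ given by $$\dot{\bar A}=\bar A\,\xi_{\rm m}-A\bar b+k_P(A-\bar A),\qquad \dot{\bar b}=-k_I\,\pi_{\mathfrak g}\big(A^T(A-\bar A)\big).$$ Let $E_g=g-F^{-1}\bar A$ and $e_b=b-\bar b$. Then there exist numbers $a>0$ and $C>0$ such that $$\|E_g(t)\|+\|e_b(t)\|\le C\big(\|E_g(0)\|+\|e_b(0)\|\big)e^{-at}$$ for all $t\ge0$ and all initial conditions $(\bar A(0),\bar b(0))\in\mathbb R^{n\times n}\times\mathfrak g$ (with $a$, $C$ not depending on the initial condition).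
   Context: $\mathrm{GL}(n)=\{A\in\mathbb R^{n\times n}\mid\det A\ne0\}$; the Lie algebra $\mathfrak g$ of $G$ is regarded as a Lie subalgebra of $\mathbb R^{n\times n}$ with the matrix commutator. $\langle A,B\rangle=\operatorname{tr}(A^TB)$ is the Euclidean inner product on $\mathbb R^{n\times n}$, and $\|A\|=\sqrt{\langle A,A\rangle}$ is the Frobenius norm. $\pi_{\mathfrak g}:\mathbb R^{n\times n}\to\mathfrak g$ is the orthogonal projection onto $\mathfrak g$ with respect to $\langle\cdot,\cdot\rangle$. $\sigma_{\min}(\cdot)$ and $\sigma_{\max}(\cdot)$ denote the minimum and maximum singular values. *)

(* Defs.v *)
From HB Require Import structures.
From mathcomp Require Import all_boot all_order all_algebra.
From mathcomp Require Import all_classical all_reals all_analysis.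
Set Implicit Arguments.
Unset Strict Implicit.
Unset Printing Implicit Defensive.
Import Order.TTheory GRing.Theory Num.Theory.
Import numFieldNormedType.Exports.
Local Open Scope classical_set_scope.
Local Open Scope ring_scope.

Definition frob_inner (R : realType) (n : nat) (A B : 'M[R]_n) : R :=
  \tr (A^T *m B).

(* The library norm `|A| on matrices is the max norm; it is used below only
   through the topology it induces. *)
Definition frob_norm (R : realType) (n : nat) (A : 'M[R]_n) : R :=
  Num.sqrt (frob_inner A A).

Definition singular_values (R : realType) (n : nat) (A : 'M[R]_n) : set R :=
  [set s | 0 <= s /\ eigenvalue (A^T *m A) (s ^+ 2)].

(* For 0 < n the set of singular values is finite and nonempty, so inf and sup
   are a minimum and a maximum. *)
Definition sigma_min (R : realType) (n : nat) (A : 'M[R]_n) : R :=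
  inf (singular_values A).

Definition sigma_max (R : realType) (n : nat) (A : 'M[R]_n) : R :=
  sup (singular_values A).

(* A subgroup of GL(n) that is closed in GL(n), though not necessarily in the
   space of all matrices. *)
Definition matrix_lie_group (R : realType) (n : nat) (G : set 'M[R]_n) : Prop :=
  [/\ forall A, G A -> A \in unitmx,
      G 1%:M,
      forall A B, G A -> G B -> G (A *m B),
      forall A, G A -> G (invmx A) &
      forall A, A \in unitmx -> closure G A -> G A].

(* The tangent space at the identity: the velocities at 0 of the differentiable
   curves ]-e, e[ -> G through the identity. *)
Definition lie_algebra (R : realType) (n : nat) (G : set 'M[R]_n) :
    set 'M[R]_n :=
  [set X | exists (e : R) (c : R -> 'M[R]_n),
    [/\ 0 < e,
        c 0 = 1%:M,
        forall t : R, `|t| < e -> G (c t) /\ derivable c t 1 &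
        is_derive (0 : R) 1 c X]].

(* The point P of S with X - P orthogonal to S. It exists and is unique when S
   is a linear subspace; otherwise 0 serves as a default value. *)
Definition orth_proj (R : realType) (n : nat) (S : set 'M[R]_n)
    (X : 'M[R]_n) : 'M[R]_n :=
  xget 0 [set P | S P /\ forall Y, S Y -> frob_inner (X - P) Y = 0].

(* df is the derivative of f on [0, +oo[, one-sided at 0; the values of f and
   df at negative times are irrelevant. *)
Definition is_derive_ge0 (R : realType) (n : nat) (f df : R -> 'M[R]_n) :
    Prop :=
  (forall t : R, 0 < t -> is_derive t 1 f (df t)) /\
  h^-1 *: (f h - f 0) @[h --> 0^'+] --> df 0.

(* A trajectory (g, xi) in G x Lie(G) of g' = g xi on [0, +oo[. *)
Definition group_trajectory (R : realType) (n : nat) (G : set 'M[R]_n)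
    (g xi : R -> 'M[R]_n) : Prop :=
  (forall t : R, 0 <= t -> G (g t) /\ lie_algebra G (xi t)) /\
  is_derive_ge0 g (fun t => g t *m xi t).

Definition observer_solution (R : realType) (n : nat) (G : set 'M[R]_n)
    (kP kI : R) (A xim Abar bbar : R -> 'M[R]_n) : Prop :=
  [/\ forall t : R, 0 <= t -> lie_algebra G (bbar t),
      is_derive_ge0 Abar
        (fun t => Abar t *m xim t - A t *m bbar t + kP *: (A t - Abar t)) &
      is_derive_ge0 bbar
        (fun t => - (kI *: orth_proj (lie_algebra G)
                              ((A t)^T *m (A t - Abar t))))].

(* Main.v *)
Require Import Defs.
From HB Require Import structures.
From mathcomp Require Import all_boot all_order all_algebra.
From mathcomp Require Import all_classical all_reals all_analysis.
From mathcomp Require Import ring lra.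
Set Implicit Arguments.
Unset Strict Implicit.
Unset Printing Implicit Defensive.
Import Order.TTheory GRing.Theory Num.Theory.
Import numFieldNormedType.Exports.
Local Open Scope classical_set_scope.
Local Open Scope ring_scope.

(** Let [M = F g], [E = M - Abar] and [e = b - bbar], so that [E = F Eg]. The
    errors satisfy
      [E' = E xim - M e - kP E]   and   [e' = kI pi(M^T E)],
    with [pi] the orthogonal projection onto the Lie algebra. As [e] lies in the
    Lie algebra, [<pi(M^T E), e> = <E, M e>], and the energy
    [|E|^2 / 2 + |e|^2 / (2 kI)] has derivative
    [<E, E xim> - kP |E|^2], which is at most [- (kP - Bxi - Bb) |E|^2]. This
    says nothing about [e]. But the derivative of [<E, M e>] contains
    [- |M e|^2], which is at most [- m^2 |e|^2] because the singular values of
    [g] are bounded below, and its other terms all carry a factor [|E|]. Adding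
    [eps <E, M e>] to the energy, with [eps] small, thus gives a function
    comparable to [|E|^2 + |e|^2] whose derivative is at most a negative multiple
    of it ([lyapunov_dot_le], [lyapunov_bounds], [cross_weight_exists]), and it
    decays exponentially ([exp_decay]).

    Three facts support this. The set of velocities of curves in [G] is a linear
    subspace ([lie_algebra_subspace]), so it contains [e] and the orthogonal
    projection onto it exists ([orth_projP]). The extreme singular values, given
    as an infimum and a supremum, do bound [|g X| / |X|] ([sigma_min_mulmx],
    [sigma_max_mulmx]); this rests on the existence of a least eigenvalue of a
    symmetric matrix, obtained from a supremum ([symmetric_min_eigenvalue]).
    Finally, the one-sided derivatives at the initial time make the Lyapunov
    function right-continuous there, so that the estimate starts at time 0. *)

(** * The Frobenius inner product *)

(** [Sb * (Sa * Sb - S ^ 2)] is the squared norm of [Sb a - S b], where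
    [S = <a, b>], [Sa = <a, a>] and [Sb = <b, b>]; the case [Sb = 0] is apart. *)
Lemma cauchy_schwarz_sum (R : realType) (I : finType) (a b : I -> R) :
  (\sum_i a i * b i) ^+ 2 <= (\sum_i a i ^+ 2) * (\sum_i b i ^+ 2).
Proof.
set S := \sum_i a i * b i; set Sa := \sum_i a i ^+ 2; set Sb := \sum_i b i ^+ 2.
have Sb0 : 0 <= Sb by apply: sumr_ge0 => i _; exact: sqr_ge0.
have key : 0 <= Sb * (Sa * Sb - S ^+ 2).
  suff -> : Sb * (Sa * Sb - S ^+ 2) = \sum_i (a i * Sb - b i * S) ^+ 2.
    by apply: sumr_ge0 => i _; exact: sqr_ge0.
  transitivity (\sum_i (a i ^+ 2 * Sb ^+ 2 - a i * b i * (2 * Sb * S)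
                        + b i ^+ 2 * S ^+ 2)).
    rewrite big_split sumrB -!mulr_suml -/S -/Sa -/Sb /=; ring.
  by apply: eq_bigr => i _; ring.
have [Sb_eq0|Sb_neq0] := eqVneq Sb 0; last first.
  by move: key; rewrite pmulr_rge0 ?subr_ge0// lt_def Sb_neq0.
have b0 i : b i = 0.
  apply/eqP; rewrite -sqrf_eq0; move/eqP: Sb_eq0.
  rewrite psumr_eq0; last by move=> j _; exact: sqr_ge0.
  by move/allP => /(_ i); rewrite mem_index_enum; exact.
have -> : S = 0 by rewrite /S big1// => i _; rewrite b0 mulr0.
by rewrite Sb_eq0 mulr0 expr0n.
Qed.

Lemma frob_innerE (R : realType) (n : nat) (A B : 'M[R]_n) :
  frob_inner A B = \sum_(p : 'I_n * 'I_n) A p.1 p.2 * B p.1 p.2.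
Proof.
rewrite /frob_inner /mxtrace.
under eq_bigr do rewrite mxE.
rewrite exchange_big pair_big /=.
by apply: eq_bigr => p _; rewrite mxE.
Qed.

Section frobenius.
Variables (R : realType) (n : nat).
Implicit Types A B C S X Y Z : 'M[R]_n.

Lemma frob_innerC A B : frob_inner A B = frob_inner B A.
Proof. by rewrite !frob_innerE; apply: eq_bigr => p _; rewrite mulrC. Qed.

Lemma frob_innerDr A B C : frob_inner A (B + C) = frob_inner A B + frob_inner A C.
Proof. by rewrite /frob_inner mulmxDr mxtraceD. Qed.

Lemma frob_innerZr A k B : frob_inner A (k *: B) = k * frob_inner A B.
Proof. by rewrite /frob_inner -scalemxAr mxtraceZ. Qed.

Lemma frob_innerNr A B : frob_inner A (- B) = - frob_inner A B.
Proof. by rewrite -scaleN1r frob_innerZr mulN1r. Qed.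

Lemma frob_innerBr A B C : frob_inner A (B - C) = frob_inner A B - frob_inner A C.
Proof. by rewrite frob_innerDr frob_innerNr. Qed.

Lemma frob_innerDl A B C : frob_inner (A + B) C = frob_inner A C + frob_inner B C.
Proof. by rewrite !(frob_innerC _ C) frob_innerDr. Qed.

Lemma frob_innerZl A k B : frob_inner (k *: A) B = k * frob_inner A B.
Proof. by rewrite !(frob_innerC _ B) frob_innerZr. Qed.

Lemma frob_innerNl A B : frob_inner (- A) B = - frob_inner A B.
Proof. by rewrite !(frob_innerC _ B) frob_innerNr. Qed.

Lemma frob_innerBl A B C : frob_inner (A - B) C = frob_inner A C - frob_inner B C.
Proof. by rewrite frob_innerDl frob_innerNl. Qed.

Lemma frob_inner_mulmxl A B C :
  frob_inner (A *m B) C = frob_inner B (A^T *m C).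
Proof. by rewrite /frob_inner trmx_mul mulmxA. Qed.

Lemma frob_inner_mulmxr A B C :
  frob_inner (A *m B) C = frob_inner A (C *m B^T).
Proof.
by rewrite /frob_inner trmx_mul mulmxA [RHS]mxtrace_mulC mulmxA.
Qed.

Lemma frob_inner_tr A B : frob_inner A^T B^T = frob_inner A B.
Proof. by rewrite /frob_inner -mxtrace_tr trmx_mul !trmxK mxtrace_mulC. Qed.

Lemma frob_inner_ge0 A : 0 <= frob_inner A A.
Proof. by rewrite frob_innerE; apply: sumr_ge0 => p _; exact: sqr_ge0. Qed.

Lemma frob_inner_eq0 A : frob_inner A A = 0 -> A = 0.
Proof.
rewrite frob_innerE => /eqP; rewrite psumr_eq0; last first.
  by move=> p _; exact: sqr_ge0.
move=> /allP A0; apply/matrixP => i j; rewrite mxE; apply/eqP.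
by move: (A0 (i, j) (mem_index_enum _)) => /=; rewrite mulf_eq0 orbb.
Qed.

Lemma sqr_frob_norm A : frob_norm A ^+ 2 = frob_inner A A.
Proof. by rewrite sqr_sqrtr// frob_inner_ge0. Qed.

Lemma frob_norm_ge0 A : 0 <= frob_norm A.
Proof. exact: sqrtr_ge0. Qed.

Lemma frob_normN A : frob_norm (- A) = frob_norm A.
Proof. by rewrite /frob_norm frob_innerNl frob_innerNr opprK. Qed.

Lemma frob_norm_tr A : frob_norm A^T = frob_norm A.
Proof. by rewrite /frob_norm frob_inner_tr. Qed.

Lemma sqr_frob_inner_le A B :
  frob_inner A B ^+ 2 <= (frob_norm A * frob_norm B) ^+ 2.
Proof.
rewrite exprMn !sqr_frob_norm !frob_innerE.
have -> (C : 'M[R]_n) : \sum_(p : 'I_n * 'I_n) C p.1 p.2 * C p.1 p.2 =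
    \sum_(p : 'I_n * 'I_n) C p.1 p.2 ^+ 2 by [].
exact: cauchy_schwarz_sum.
Qed.

Lemma frob_inner_le A B : frob_inner A B <= frob_norm A * frob_norm B.
Proof.
have AB0 : 0 <= frob_norm A * frob_norm B by rewrite mulr_ge0 ?frob_norm_ge0.
apply: le_trans (ler_norm _) _.
by rewrite -ler_sqr ?nnegrE// real_normK ?num_real// sqr_frob_inner_le.
Qed.

Lemma frob_inner_geN A B : - (frob_norm A * frob_norm B) <= frob_inner A B.
Proof. by rewrite lerNl -frob_innerNl -[frob_norm A]frob_normN frob_inner_le. Qed.

Lemma frob_normD A B : frob_norm (A + B) <= frob_norm A + frob_norm B.
Proof.
have := frob_inner_le A B; have := frob_norm_ge0 A; have := frob_norm_ge0 B.
move=> hB hA hAB; rewrite -ler_sqr ?nnegrE ?addr_ge0 ?frob_norm_ge0//.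
rewrite sqr_frob_norm frob_innerDl !frob_innerDr (frob_innerC B A).
by rewrite -!sqr_frob_norm sqrrD mulr2n; lra.
Qed.

(** Cauchy-Schwarz on every entry of the product. *)
Lemma frob_normM A B : frob_norm (A *m B) <= frob_norm A * frob_norm B.
Proof.
rewrite -ler_sqr ?nnegrE ?mulr_ge0 ?frob_norm_ge0// exprMn !sqr_frob_norm.
have frobE C : frob_inner C C = \sum_i \sum_j C i j ^+ 2.
  by rewrite frob_innerE pair_big.
rewrite frobE [frob_inner A A]frobE -[frob_inner B B]frob_inner_tr frobE.
rewrite mulr_suml; apply: ler_sum => i _; rewrite mulr_sumr.
apply: ler_sum => j _; rewrite !mxE.
under [X in _ <= _ * X]eq_bigr do rewrite mxE.
exact: cauchy_schwarz_sum.
Qed.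

(** * Singular values bound the norm of a product *)

(** A positive semidefinite invertible form is coercive. Positivity at
    [X - t X S], with [t] of the order of [1 / |S|], bounds [|X S|] by the form,
    and [X = (X S) S^-1]. *)
Lemma psd_unit_coercive S : S^T = S -> S \in unitmx ->
  (forall X, 0 <= frob_inner X (X *m S)) ->
  exists2 c, 0 < c & forall X, c * frob_inner X X <= frob_inner X (X *m S).
Proof.
move=> Ssym Su Spsd.
pose q := frob_norm S + 1; pose s := frob_norm (invmx S) + 1.
have q0 : 0 < q by rewrite ltr_wpDl ?frob_norm_ge0.
have s0 : 0 < s by rewrite ltr_wpDl ?frob_norm_ge0.
exists (q^-1 * (s ^+ 2)^-1); first by rewrite mulr_gt0 ?invr_gt0// exprn_gt0.
move=> X; set Y := X *m S.
have YY0 := frob_inner_ge0 Y.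
have XY : frob_inner X (Y *m S) = frob_inner Y Y.
  by rewrite -{1}Ssym -frob_inner_mulmxr.
have YSY : frob_inner Y (Y *m S) <= q * frob_inner Y Y.
  apply: le_trans (frob_inner_le _ _) _.
  rewrite -sqr_frob_norm expr2 mulrA mulrC.
  rewrite ler_wpM2r ?frob_norm_ge0// (le_trans (frob_normM _ _))//.
  by rewrite mulrC ler_wpM2r ?frob_norm_ge0// lerDl.
have hY : q^-1 * frob_inner Y Y <= frob_inner X Y.
  have := Spsd (X - q^-1 *: Y).
  rewrite mulmxBl -scalemxAl -/Y !(frob_innerBl, frob_innerBr).
  rewrite !(frob_innerZl, frob_innerZr) XY => h.
  have : q^-1 * (q^-1 * frob_inner Y (Y *m S)) <= q^-1 * frob_inner Y Y.
    by rewrite ler_wpM2l ?invr_ge0 ?(ltW q0)// ler_pdivrMl.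
  lra.
have hX : (s ^+ 2)^-1 * frob_inner X X <= frob_inner Y Y.
  rewrite ler_pdivrMl ?exprn_gt0// -!sqr_frob_norm -exprMn.
  rewrite ler_sqr ?nnegrE ?mulr_ge0 ?frob_norm_ge0 ?(ltW s0)//.
  rewrite -[X in frob_norm X <= _](mulmxK Su) -/Y mulrC.
  rewrite (le_trans (frob_normM _ _))// ler_wpM2l ?frob_norm_ge0//.
  by rewrite lerDl.
rewrite -mulrA; apply: le_trans hY.
by rewrite ler_wpM2l// invr_ge0 ltW.
Qed.

Lemma nonunit_eigenvalue S a : S - a%:M \notin unitmx -> eigenvalue S a.
Proof. by rewrite -row_free_unit -kermx_eq0. Qed.

(** The largest [a] for which [a <X, X> <= <X, X S>] holds is an eigenvalue,
    since [S - a] would otherwise be coercive and [a] could be increased. *)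
Lemma symmetric_min_eigenvalue S : (0 < n)%N -> S^T = S ->
  exists2 a, eigenvalue S a &
    forall X, a * frob_inner X X <= frob_inner X (X *m S).
Proof.
move=> n0 Ssym.
pose D := [set r | forall X, r * frob_inner X X <= frob_inner X (X *m S)].
have I0 : 0 < frob_inner (1%:M : 'M[R]_n) 1%:M.
  by rewrite /frob_inner trmx1 mulmx1 mxtrace1 ltr0n.
have D0 : D (- frob_norm S).
  move=> X; rewrite mulNr -sqr_frob_norm expr2.
  apply: le_trans (frob_inner_geN _ _); rewrite lerN2 [leRHS]mulrC -mulrA.
  by rewrite ler_wpM2l ?frob_norm_ge0// frob_normM.
have Dub : ubound D (frob_inner 1%:M S / frob_inner (1%:M : 'M[R]_n) 1%:M).
  by move=> r /(_ 1%:M); rewrite mul1mx ler_pdivlMr.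
have supD : has_sup D by split; [exists (- frob_norm S)|exists (frob_inner 1%:M S / frob_inner (1%:M : 'M[R]_n) 1%:M)].
have Dsup : D (sup D).
  move=> X.
  have [X0|X0] := eqVneq (frob_inner X X) 0.
    by rewrite (frob_inner_eq0 X0) mul0mx /frob_inner mulmx0 mxtrace0 mulr0.
  have XX : 0 < frob_inner X X by rewrite lt_def X0 frob_inner_ge0.
  rewrite -ler_pdivlMr//; apply: ge_sup; first by exists (- frob_norm S).
  by move=> r /(_ X); rewrite ler_pdivlMr.
exists (sup D) => //; apply: nonunit_eigenvalue; apply/negP => Su.
set T := S - (sup D)%:M in Su.
have XT X : frob_inner X (X *m T) = frob_inner X (X *m S) - sup D * frob_inner X X.
  by rewrite mulmxBr mul_mx_scalar frob_innerBr frob_innerZr.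
have [| |c c0 cT] := @psd_unit_coercive T _ Su.
- by rewrite /T linearB /= tr_scalar_mx Ssym.
- by move=> X; rewrite XT subr_ge0; exact: Dsup.
have : sup D + c <= sup D.
  by apply: ub_le_sup; [case: supD|move=> X; have := cT X; rewrite XT; lra].
by rewrite gerDl leNgt c0.
Qed.

(** Quadratic forms are evaluated on square matrices, so an eigenvector is
    repeated on every row. *)
Lemma eigenvalue_rayleigh S a : (0 < n)%N -> eigenvalue S a ->
  exists2 X, 0 < frob_inner X X & frob_inner X (X *m S) = a * frob_inner X X.
Proof.
move=> n0 /eigenvalueP[v vS v0].
pose X := (const_mx 1 : 'cV[R]_n) *m v.
have XE i j : X i j = v 0 j by rewrite !mxE big_ord1 mxE mul1r.
exists X; last by rewrite -mulmxA vS -scalemxAr frob_innerZr.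
rewrite lt_def frob_inner_ge0 andbT; apply: contra_neq v0 => /frob_inner_eq0 X0.
by apply/rowP => j; rewrite -(XE (Ordinal n0)) X0 !mxE.
Qed.

Lemma gramE A X : frob_inner X (X *m (A^T *m A)) = frob_norm (A *m X^T) ^+ 2.
Proof.
by rewrite mulmxA -{2}[A]trmxK -frob_inner_mulmxr -frob_inner_tr trmx_mul trmxK
  sqr_frob_norm.
Qed.

Lemma gram_sym A : (A^T *m A)^T = A^T *m A.
Proof. by rewrite trmx_mul trmxK. Qed.

(** The least eigenvalue of [A^T A] is nonnegative and its square root is a
    singular value, hence at least [sigma_min A]. The hypothesis
    [0 <= sigma_min A] lets the inequality be squared. *)
Lemma sigma_min_mulmx A X : (0 < n)%N -> 0 <= sigma_min A ->
  sigma_min A * frob_norm X <= frob_norm (A *m X).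
Proof.
move=> n0 sA; have [a aA aX] := symmetric_min_eigenvalue n0 (gram_sym A).
have a0 : 0 <= a.
  have [Y Y0] := eigenvalue_rayleigh n0 aA.
  by rewrite gramE => h; rewrite -(pmulr_lge0 _ Y0) -h sqr_ge0.
have sa : sigma_min A <= Num.sqrt a.
  apply: ge_inf; first by exists 0 => s [].
  by split; [exact: sqrtr_ge0|rewrite sqr_sqrtr].
rewrite -ler_sqr ?nnegrE ?mulr_ge0 ?frob_norm_ge0// -[X in frob_norm (_ *m X)]trmxK.
rewrite -gramE; apply: le_trans (aX _).
rewrite frob_inner_tr exprMn sqr_frob_norm ler_wpM2r ?frob_inner_ge0//.
by rewrite -(sqr_sqrtr a0) ler_sqr ?nnegrE ?sqrtr_ge0.
Qed.

(** The largest eigenvalue of [A^T A] is minus the least one of [- A^T A]; it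
    bounds all the others, so the supremum of the singular values is a genuine
    upper bound. *)
Lemma sigma_max_mulmx A X : (0 < n)%N ->
  frob_norm (A *m X) <= sigma_max A * frob_norm X.
Proof.
move=> n0.
have [|a aA aX] := @symmetric_min_eigenvalue (- (A^T *m A)) n0.
  by rewrite linearN /= gram_sym.
have {}aX Y : frob_norm (A *m Y^T) ^+ 2 <= - a * frob_inner Y Y.
  by have := aX Y; rewrite mulmxN frob_innerNr gramE; lra.
have [Y Y0 aY] := eigenvalue_rayleigh n0 aA.
have a0 : 0 <= - a.
  by rewrite -(pmulr_lge0 _ Y0) (le_trans (sqr_ge0 _) (aX Y)).
have {}aA : eigenvalue (A^T *m A) (- a).
  move: aA => /eigenvalueP[v vS v0]; apply/eigenvalueP; exists v => //.
  by rewrite scaleNr -vS mulmxN opprK.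
have sa : Num.sqrt (- a) <= sigma_max A.
  apply: ub_le_sup; last by split; [exact: sqrtr_ge0|rewrite sqr_sqrtr].
  exists (Num.sqrt (- a)) => s [s0 /(eigenvalue_rayleigh n0)[Z Z0]].
  rewrite gramE => h; rewrite -ler_sqr ?nnegrE ?sqrtr_ge0// sqr_sqrtr//.
  by rewrite -(ler_pM2r Z0) -h.
have s0 : 0 <= sigma_max A by apply: le_trans sa; exact: sqrtr_ge0.
rewrite -ler_sqr ?nnegrE ?mulr_ge0 ?frob_norm_ge0// -[X in frob_norm (_ *m X)]trmxK.
apply: le_trans (aX _) _.
rewrite frob_inner_tr exprMn sqr_frob_norm ler_wpM2r ?frob_inner_ge0//.
by rewrite -(sqr_sqrtr a0) ler_sqr ?nnegrE ?sqrtr_ge0.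
Qed.

(** * Orthogonal projection onto a subspace of matrices *)

Definition linear_subspace (S : set 'M[R]_n) :=
  [/\ S 0, forall X Y, S X -> S Y -> S (X + Y) &
      forall (k : R) X, S X -> S (k *: X)].

(** Among the finite dimensional subspaces contained in [S], one of maximal
    dimension must absorb every element of [S]. *)
Lemma subspace_vspace (S : set 'M[R]_n) : linear_subspace S ->
  exists U : {vspace 'M[R]_n}, forall X, X \in U <-> S X.
Proof.
case=> S0 SD SZ.
pose P k := `[< exists U : {vspace 'M[R]_n}, (forall X, X \in U -> S X) /\ \dim U = k >].
have exP : exists k, P k.
  exists 0%N; apply/asboolP; exists 0%VS; split; last by rewrite dimv0.
  by move=> X; rewrite memv0 => /eqP ->.
have ubP k : P k -> (k <= \dim {: 'M[R]_n})%N.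
  by move=> /asboolP[U [_ <-]]; apply: dimvS; exact: subvf.
have [d /asboolP[U [US Ud]] dmax] := ex_maxnP exP ubP.
exists U => X; split=> [|SX]; first exact: US.
have : P (\dim (U + <[X]>)%VS).
  apply/asboolP; exists (U + <[X]>)%VS; split=> // _ /memv_addP[Y YU [Z ZX ->]].
  by case/vlineP: ZX => k ->; apply: SD; [exact: US|exact: SZ].
move/dmax; rewrite -Ud => dU.
have /eqP -> : U == (U + <[X]>)%VS by rewrite eqEdim addvSl dU.
by rewrite memvE addvSr.
Qed.

(** Pairing with a basis of [U] is injective on [U] and lands in a space of the
    dimension of [U], hence every [X] pairs with the basis as some element of
    [U] does. *)
Lemma orth_proj_exists (U : {vspace 'M[R]_n}) X :
  exists2 P, P \in U & forall Y, Y \in U -> frob_inner (X - P) Y = 0.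
Proof.
pose phi Z := \row_(i < \dim U) frob_inner Z (vbasis U)`_i.
have phi_lin : linear phi.
  by move=> k Z Z'; apply/rowP => i; rewrite !mxE frob_innerDl frob_innerZl.
pose phiL := GRing.isLinear.Build R 'M[R]_n 'rV[R]_(\dim U) _ phi phi_lin.
pose phi' : {linear 'M[R]_n -> 'rV[R]_(\dim U)} := HB.pack phi phiL.
pose f := linfun phi'.
have fE Z : f Z = phi Z by rewrite lfunE.
have orth Z : phi Z = 0 -> forall Y, Y \in U -> frob_inner Z Y = 0.
  move=> /rowP Z0 Y YU; rewrite (coord_vbasis YU).
  apply: (big_ind (fun W => frob_inner Z W = 0)).
  - by rewrite /frob_inner mulmx0 mxtrace0.
  - by move=> V W ZV ZW; rewrite frob_innerDr ZV ZW addr0.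
  - by move=> i _; rewrite frob_innerZr; have := Z0 i; rewrite !mxE => ->; rewrite mulr0.
have capU : (U :&: lker f = 0)%VS.
  apply/eqP; rewrite -subv0; apply/subvP => Z.
  rewrite memv_cap memv_ker fE memv0 => /andP[ZU /eqP Z0].
  by apply/eqP/frob_inner_eq0; exact: orth.
have fU : (f @: U = fullv)%VS.
  apply/eqP; rewrite eqEdim subvf /= limg_dim_eq// dimvf.
  by rewrite dim_matrix mul1r.
have : f X \in (f @: U)%VS by rewrite fU memvf.
move=> /memv_imgP[P PU fP]; exists P => //; apply: orth.
by rewrite -fE linearB /= fP subrr.
Qed.

(** On a subspace the default value of [orth_proj] is never taken. *)
Lemma orth_projP (S : set 'M[R]_n) X : linear_subspace S ->
  S (orth_proj S X) /\
  forall Y, S Y -> frob_inner (orth_proj S X) Y = frob_inner X Y.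
Proof.
move=> /subspace_vspace[U US].
rewrite /orth_proj; case: xgetP => [P _ [SP orthP]|noP].
  split=> // Y /orthP; rewrite frob_innerBl => /eqP.
  by rewrite subr_eq0 => /eqP.
have [P PU orthP] := orth_proj_exists U X.
by case: (noP P); split=> [|Y /US]; [exact/US|exact: orthP].
Qed.

Lemma frob_norm_orth_proj (S : set 'M[R]_n) X : linear_subspace S ->
  frob_norm (orth_proj S X) <= frob_norm X.
Proof.
move=> /(orth_projP X)[SP /(_ _ SP) PX]; set P := orth_proj S X in PX *.
have [P0|P0] := eqVneq (frob_norm P) 0; first by rewrite P0 frob_norm_ge0.
have P_gt0 : 0 < frob_norm P by rewrite lt_def P0 frob_norm_ge0.
by rewrite -(ler_pM2r P_gt0) -expr2 sqr_frob_norm PX frob_inner_le.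
Qed.

End frobenius.

(** * Differentiable matrix curves *)

Lemma is_derive_mulrl (R : realType) (k t : R) :
  is_derive t 1 (fun s => k * s) k.
Proof.
have := @is_deriveZ _ _ _ id k t 1 1 (is_derive_id t 1).
by rewrite [k *: 1]mulr1.
Qed.

Section curves.
Variables (R : realType) (n : nat).
Implicit Types (f h : R -> 'M[R]_n) (t : R) (df dh : 'M[R]_n).

Lemma is_derive_mxP f t (df : 'M[R]_n) :
  is_derive t 1 f df <->
  forall i j, is_derive t 1 (fun s => f s i j) (df i j).
Proof.
split=> [[fd <-] i j|fd].
  have fd' := (derivable_mxP f t 1).1 fd.
  by apply: DeriveDef => //; rewrite derive_mx// mxE.
have fd' : derivable f t 1.
  by apply/derivable_mxP => i j; exact: (@ex_derive _ _ _ _ _ _ _ (fd i j)).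
apply: DeriveDef => //; rewrite derive_mx//; apply/matrixP => i j.
by rewrite mxE (@derive_val _ _ _ _ _ _ _ (fd i j)).
Qed.

Lemma is_derive_mulmx f h t df dh :
  is_derive t 1 f df -> is_derive t 1 h dh ->
  is_derive t 1 (fun s => f s *m h s) (df *m h t + f t *m dh).
Proof.
move=> /is_derive_mxP fd /is_derive_mxP hd; apply/is_derive_mxP => i j.
have -> : (fun s => (f s *m h s) i j) =
    \sum_k ((fun s => f s i k) * (fun s => h s k j)).
  by apply/funext => s; rewrite fct_sumE mxE.
apply: is_derive_eq.
transitivity (\sum_k (f t i k * dh k j + h t k j * df i k)); first by [].
rewrite !mxE -big_split /=; apply: eq_bigr => k _.
by rewrite addrC [h t k j * _]mulrC.
Qed.

Lemma is_derive_frob_inner f h t df dh :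
  is_derive t 1 f df -> is_derive t 1 h dh ->
  is_derive t 1 (fun s => frob_inner (f s) (h s))
    (frob_inner df (h t) + frob_inner (f t) dh).
Proof.
move=> fd hd.
have fTd : is_derive t 1 (fun s => (f s)^T) df^T.
  apply/is_derive_mxP => i j; move/is_derive_mxP : fd => /(_ j i).
  rewrite mxE; congr is_derive; by apply/funext => s; rewrite mxE.
have /is_derive_mxP fhd := is_derive_mulmx fTd hd.
have -> : (fun s => frob_inner (f s) (h s)) =
    \sum_i (fun s => ((f s)^T *m h s) i i).
  by apply/funext => s; rewrite fct_sumE.
apply: is_derive_eq.
by rewrite /frob_inner -mxtraceD.
Qed.

Lemma is_derive_mulmxl (F : 'M[R]_n) f t df :
  is_derive t 1 f df -> is_derive t 1 (fun s => F *m f s) (F *m df).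
Proof.
move=> fd; apply: is_derive_eq.
  by apply: is_derive_mulmx fd; exact: is_derive_cst.
by rewrite mul0mx add0r.
Qed.

Lemma is_derive_rescale f (k t : R) df : is_derive (k * t) 1 f df ->
  is_derive t 1 (fun s => f (k * s)) (k *: df).
Proof.
move=> /is_derive_mxP fd; apply/is_derive_mxP => i j.
rewrite mxE mulrC.
exact: (@is_derive1_comp _ _ _ _ _ _ (fd i j) (is_derive_mulrl k t)).
Qed.

(** The product of two curves through the identity has the sum of their
    velocities, and a curve run at speed [k] has [k] times its velocity. *)
Lemma lie_algebra_subspace (G : set 'M[R]_n) : matrix_lie_group G ->
  linear_subspace (lie_algebra G).
Proof.
case=> _ G1 GM _ _; split.
- exists 1, (cst 1%:M); split=> //; last exact: is_derive_cst.
- move=> X Y [e [c [e0 c0 cG cX]]] [e' [c' [e'0 c'0 c'G c'Y]]].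
  exists (Num.min e e'), (fun s => c s *m c' s); split.
  + by rewrite lt_min e0.
  + by rewrite c0 c'0 mulmx1.
  + move=> t; rewrite lt_min => /andP[/cG[Gc dc] /c'G[Gc' dc']].
    split; first exact: GM.
    move/derivableP : dc => dc; move/derivableP : dc' => dc'.
    exact: (@ex_derive _ _ _ _ _ _ _ (is_derive_mulmx dc dc')).
  + apply: is_derive_eq; first exact: is_derive_mulmx cX c'Y.
    by rewrite c0 c'0 mul1mx mulmx1.
- move=> k X [e [c [e0 c0 cG cX]]].
  have k0 : 0 < `|k| + 1 by rewrite ltr_wpDl.
  exists (e / (`|k| + 1)), (fun s => c (k * s)); split.
  + by rewrite divr_gt0.
  + by rewrite mulr0.
  + move=> t; rewrite ltr_pdivlMr// => te.
    have /cG[Gc /derivableP dc] : `|k * t| < e.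
      by rewrite normrM (le_lt_trans _ te)// mulrC ler_wpM2l// lerDl.
    by split => //; exact: (@ex_derive _ _ _ _ _ _ _ (is_derive_rescale dc)).
  + by apply: is_derive_rescale; rewrite mulr0.
Qed.

(** What the mean value theorem asks for at the initial time, where only a
    one-sided derivative exists. It is stated entry by entry because products of
    matrices and inner products are sums of products of entries. *)
Definition right_continuous0 f :=
  forall i j, (fun s => f s i j) @ 0^'+ --> f 0 i j.

Lemma is_derive_ge0_right_continuous0 f (df : R -> 'M[R]_n) :
  is_derive_ge0 f df -> right_continuous0 f.
Proof.
case=> _ f0 i j.
have q : (h^-1 *: (f h - f 0)) i j @[h --> 0^'+] --> df 0 i j.
  exact: (continuous_cvg _ (@coord_continuous _ _ _ i j (df 0)) f0).
have id0 : h @[h --> (0 : R)^'+] --> (0 : R) by exact: cvg_at_right_filter.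
have : f 0 i j + h * (h^-1 *: (f h - f 0)) i j @[h --> 0^'+] -->
    f 0 i j + 0 * df 0 i j.
  by apply: cvgD; [exact: cvg_cst|exact: cvgM].
rewrite mul0r addr0; apply: cvg_trans; apply: near_eq_cvg.
near=> h.
have h0 : h != 0 by rewrite gt_eqF//; near: h; exact: nbhs_right_gt.
by rewrite !mxE mulVKf// subrKC.
Unshelve. all: by end_near. Qed.

Lemma right_continuous0_cst (F : 'M[R]_n) : right_continuous0 (cst F).
Proof. by move=> i j; exact: cvg_cst. Qed.

Lemma right_continuous0B f h : right_continuous0 f -> right_continuous0 h ->
  right_continuous0 (fun s => f s - h s).
Proof.
move=> fc hc i j; rewrite !mxE.
rewrite (_ : (fun s => (f s - h s) i j) = (fun s => f s i j - h s i j)).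
  exact: cvgB.
by apply/funext => s; rewrite !mxE.
Qed.

(** The entries of a product and the Frobenius inner product are both finite
    sums of products. *)
Lemma cvg_sum_mul (I : finType) (a b : I -> R -> R) (la lb : I -> R) :
  (forall i, a i @ 0^'+ --> la i) -> (forall i, b i @ 0^'+ --> lb i) ->
  \sum_i a i s * b i s @[s --> 0^'+] --> \sum_i la i * lb i.
Proof.
move=> ca cb; apply: cvg_big => [|i _]; last by apply: cvgM; [exact: ca|exact: cb].
exact: add_continuous.
Qed.

Lemma right_continuous0_mulmx f h : right_continuous0 f ->
  right_continuous0 h -> right_continuous0 (fun s => f s *m h s).
Proof.
move=> fc hc i j; rewrite mxE.
rewrite (_ : (fun s => (f s *m h s) i j) = (fun s => \sum_k f s i k * h s k j)).
  by apply: cvg_sum_mul => k; [exact: fc|exact: hc].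
by apply/funext => s; rewrite mxE.
Qed.

Lemma right_continuous0_frob_inner f h : right_continuous0 f ->
  right_continuous0 h ->
  frob_inner (f s) (h s) @[s --> 0^'+] --> frob_inner (f 0) (h 0).
Proof.
move=> fc hc; rewrite frob_innerE.
rewrite (_ : (fun s => frob_inner (f s) (h s)) =
    (fun s => \sum_(p : 'I_n * 'I_n) f s p.1 p.2 * h s p.1 p.2)).
  by apply: cvg_sum_mul => p; [exact: fc|exact: hc].
by apply/funext => s; rewrite frob_innerE.
Qed.

End curves.

(** Gronwall: [W s * exp (beta * s)] is nonincreasing. *)
Lemma exp_decay (R : realType) (W dW : R -> R) (beta : R) :
  W @ 0^'+ --> W 0 ->
  (forall t : R, 0 < t -> is_derive t 1 W (dW t)) ->
  (forall t : R, 0 < t -> dW t <= - (beta * W t)) ->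
  forall t : R, 0 <= t -> W t <= W 0 * expR (- (beta * t)).
Proof.
move=> W0 Wd dWle t; rewrite le_eqVlt => /predU1P[<-|t0].
  by rewrite mulr0 oppr0 expR0 mulr1.
pose f : R -> R := W * (expR \o (fun s => beta * s)).
have fE s : f s = W s * expR (beta * s) by [].
have ed (s : R) : is_derive s 1 (expR \o (fun s => beta * s)) (expR (beta * s) * beta).
  exact: (@is_derive1_comp _ _ _ _ _ _ _ (is_derive_mulrl beta s)).
have fd (s : R) : 0 < s -> is_derive s 1 f
    (W s *: (expR (beta * s) * beta) + expR (beta * s) *: dW s).
  by move=> s0; apply: is_deriveM; exact: Wd.
have fder (s : R) : 0 < s -> derivable f s 1.
  by move=> /fd h; exact: (@ex_derive _ _ _ _ _ _ _ h).
have ec (s : R) : {for s, continuous (expR \o (fun s => beta * s))}.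
  apply/differentiable_continuous/derivable1_diffP.
  exact: (@ex_derive _ _ _ _ _ _ _ (ed s)).
have fc (s : R) : 0 < s -> {for s, continuous f}.
  by move=> s0; apply/differentiable_continuous/derivable1_diffP; exact: fder.
have f0t : f t <= f 0.
  apply: (@ler0_derive1_le_cc _ f 0 t) => //.
  - by move=> x; rewrite in_itv /= => /andP[x0 _]; exact: fder.
  - move=> x; rewrite in_itv /= => /andP[x0 _].
    rewrite derive1E (@derive_val _ _ _ _ _ _ _ (fd x x0)) /GRing.scale /=.
    have := dWle x x0; rewrite -(ler_pM2l (expR_gt0 (beta * x))); lra.
  - apply/continuous_within_itvP => //; split.
    + by move=> x; rewrite in_itv /= => /andP[x0 _]; exact: fc.
    + by apply: cvgM => //; apply: cvg_at_right_filter; exact: ec.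
    + by apply: cvg_at_left_filter; exact: fc.
  - by rewrite in_itv /= lexx ltW.
  - by rewrite in_itv /= lexx ltW.
  - exact: ltW.
have -> : W 0 = f 0 by rewrite fE mulr0 expR0 mulr1.
apply: le_trans (ler_wpM2r (expR_ge0 _) f0t).
by rewrite fE -mulrA -expRD subrr expR0 mulr1.
Qed.

(** * The Lyapunov function *)

Section lyapunov.
Variables (R : realType) (n : nat).
Implicit Types (E e M P X Xm : 'M[R]_n).

(** The first two terms form the natural energy of the observer. Its derivative
    controls [E] but not [e]; the cross term makes up for that, since its
    derivative contains [- |M e| ^ 2]. *)
Definition lyapunov (kI eps : R) M E e : R :=
  2^-1 * frob_inner E E + (2 * kI)^-1 * frob_inner e e
    + eps * frob_inner E (M *m e).

(** The derivative of [lyapunov] along curves with velocities [dM], [dE] and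
    [de]. *)
Definition lyapunov_dot (kI eps : R) M dM E dE e de : R :=
  frob_inner E dE + kI^-1 * frob_inner e de
    + eps * (frob_inner dE (M *m e) + frob_inner E (dM *m e + M *m de)).

Lemma is_derive_lyapunov (kI eps t : R) (M E e : R -> 'M[R]_n) dM dE de :
  is_derive t 1 M dM -> is_derive t 1 E dE -> is_derive t 1 e de ->
  is_derive t 1 (fun s => lyapunov kI eps (M s) (E s) (e s))
    (lyapunov_dot kI eps (M t) dM (E t) dE (e t) de).
Proof.
move=> Md Ed ed.
have d1 := is_derive_frob_inner Ed Ed.
have d2 := is_derive_frob_inner ed ed.
have d3 := is_derive_frob_inner Ed (is_derive_mulmx Md ed).
have d := is_deriveD (is_deriveD (is_deriveZ 2^-1 d1)
  (is_deriveZ (2 * kI)^-1 d2)) (is_deriveZ eps d3).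
apply: (is_derive_eq d).
rewrite /lyapunov_dot /GRing.scale /= (frob_innerC dE (E t)).
rewrite (frob_innerC de (e t)) invfM; move: kI^-1 => k.
lra.
Qed.

(** In the derivative of the energy the terms [<E, M e>] cancel, because [P]
    pairs with [e] as [M^T E] does; what remains of it is at most
    [- (kP - K) |E| ^ 2]. The weighted cross term contributes
    [- eps |M e| ^ 2] and terms with a factor [|E|]. *)
Lemma lyapunov_dot_le (kI kP eps K Bx al m : R) M Xi Xm E e P :
  0 < kI -> 0 <= kP -> 0 <= eps -> 0 <= al -> 0 <= m ->
  frob_norm Xm <= K -> frob_norm Xi <= Bx -> frob_norm M <= al ->
  m * frob_norm e <= frob_norm (M *m e) ->
  frob_inner P e = frob_inner (M^T *m E) e ->
  frob_norm P <= frob_norm (M^T *m E) ->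
  lyapunov_dot kI eps M (M *m Xi) E (E *m Xm - M *m e - kP *: E) e (kI *: P)
    <= - (kP - K - eps * (kI * al ^+ 2)) * frob_norm E ^+ 2
       + eps * (al * (K + kP + Bx)) * (frob_norm E * frob_norm e)
       - eps * m ^+ 2 * frob_norm e ^+ 2.
Proof.
move=> kI0 kP0 eps0 al0 m0 XmK XiB Mal me Pe PME.
set x := frob_norm E; set y := frob_norm e in me *.
have x0 : 0 <= x := frob_norm_ge0 _; have y0 : 0 <= y := frob_norm_ge0 _.
have normM_le (U V : 'M[R]_n) u v : frob_norm U <= u -> frob_norm V <= v ->
    frob_norm (U *m V) <= u * v.
  by move=> Uu Vv; apply: le_trans (frob_normM _ _) _;
    rewrite ler_pM ?frob_norm_ge0.
have inner_le (U V : 'M[R]_n) u v : frob_norm U <= u -> frob_norm V <= v ->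
    frob_inner U V <= u * v.
  by move=> Uu Vv; apply: le_trans (frob_inner_le _ _) _;
    rewrite ler_pM ?frob_norm_ge0.
have Me : frob_norm (M *m e) <= al * y by exact: normM_le.
have EXm : frob_norm (E *m Xm) <= x * K by exact: normM_le.
have MT : frob_norm (M^T *m E) <= al * x by apply/normM_le; rewrite ?frob_norm_tr.
have h1 : frob_inner E (E *m Xm) <= x * (x * K) by exact: inner_le.
have h2 : frob_inner (E *m Xm) (M *m e) <= x * K * (al * y) by exact: inner_le.
have h3 : - frob_inner E (M *m e) <= x * (al * y).
  by rewrite -frob_innerNl; apply/inner_le; rewrite ?frob_normN.
have h4 : frob_inner E (M *m Xi *m e) <= x * (al * Bx * y).
  by apply/inner_le => //; apply/normM_le => //; exact: normM_le.
have h5 : frob_inner E (M *m P) <= x * (al * (al * x)).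
  by apply/inner_le => //; apply/normM_le => //; exact: le_trans MT.
have h6 : m ^+ 2 * y ^+ 2 <= frob_inner (M *m e) (M *m e).
  by rewrite -sqr_frob_norm -exprMn ler_sqr ?nnegrE ?mulr_ge0 ?frob_norm_ge0.
have PeE : frob_inner e P = frob_inner E (M *m e).
  by rewrite frob_innerC Pe frob_inner_mulmxl trmxK.
rewrite /lyapunov_dot -scalemxAr.
rewrite !(frob_innerDr, frob_innerBr, frob_innerDl, frob_innerBl, frob_innerZl,
  frob_innerZr, frob_innerNr, frob_innerNl) PeE -(sqr_frob_norm E) -/x mulKf ?gt_eqF//.
set a1 := frob_inner E (E *m Xm) in h1 *.
set a2 := frob_inner (E *m Xm) _ in h2 *.
set a3 := frob_inner E (M *m e) in h3 *.
set a4 := frob_inner E (M *m Xi *m e) in h4 *.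
set a5 := frob_inner E (M *m P) in h5 *.
set a6 := frob_inner (M *m e) _ in h6 *.
have h3' : - (kP * a3) <= kP * (x * (al * y)) by rewrite -mulrN ler_wpM2l.
have h5' : kI * a5 <= kI * (x * (al * (al * x))) by rewrite ler_wpM2l// ltW.
have : eps * (a2 - a6 - kP * a3 + (a4 + kI * a5)) <=
    eps * (x * K * (al * y) - m ^+ 2 * y ^+ 2 + kP * (x * (al * y))
           + (x * (al * Bx * y) + kI * (x * (al * (al * x))))).
  by rewrite ler_wpM2l//; lra.
nra.
Qed.

(** The condition [eps * al <= p] makes the cross term at most half of the
    energy, which is at least [p * (|E| ^ 2 + |e| ^ 2)]. *)
Lemma lyapunov_bounds (kI eps al p : R) M E e :
  0 < kI -> 0 <= eps -> frob_norm M <= al -> eps * al <= p ->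
  p <= 2^-1 -> p <= (2 * kI)^-1 ->
  p / 2 * (frob_norm E ^+ 2 + frob_norm e ^+ 2) <= lyapunov kI eps M E e /\
  lyapunov kI eps M E e <=
    (2^-1 + (2 * kI)^-1 + p) * (frob_norm E ^+ 2 + frob_norm e ^+ 2).
Proof.
move=> kI0 eps0 Mal epsp p2 pkI.
set x := frob_norm E; set y := frob_norm e; set N := x ^+ 2 + y ^+ 2.
have x0 : 0 <= x := frob_norm_ge0 _; have y0 : 0 <= y := frob_norm_ge0 _.
have Me : frob_norm (M *m e) <= al * y.
  by apply: le_trans (frob_normM _ _) _; rewrite ler_wpM2r.
have p0 : 0 <= p.
  by apply: le_trans epsp; rewrite mulr_ge0// (le_trans (frob_norm_ge0 M)).
have cross (c : R) : c <= x * (al * y) -> eps * c <= p / 2 * N.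
  move=> cxy; apply: (@le_trans _ _ (eps * (x * (al * y)))); first by rewrite ler_wpM2l.
  have : (eps * al) * (x * y) <= p * (x * y) by rewrite ler_wpM2r// mulr_ge0.
  have : p * (x * y) <= p * (N / 2).
    by rewrite ler_wpM2l// /N; have := sqr_ge0 (x - y); lra.
  lra.
have xMe : x * frob_norm (M *m e) <= x * (al * y) by rewrite ler_wpM2l.
have u := cross _ (le_trans (frob_inner_le E (M *m e)) xMe).
have l : eps * - frob_inner E (M *m e) <= p / 2 * N.
  by apply: cross; rewrite lerNl (le_trans _ (frob_inner_geN _ _))// lerN2.
rewrite /lyapunov -!sqr_frob_norm -/x -/y; rewrite mulrN in l.
have N0 : 0 <= x ^+ 2 /\ 0 <= y ^+ 2 by rewrite !sqr_ge0.
set k := (2 * kI)^-1 in pkI *.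
have h1 : p * x ^+ 2 <= 2^-1 * x ^+ 2 by rewrite ler_wpM2r// (N0.1).
have h2 : p * y ^+ 2 <= k * y ^+ 2 by rewrite ler_wpM2r// (N0.2).
have h3 : 0 <= p * x ^+ 2 by rewrite mulr_ge0// (N0.1).
have h4 : 0 <= p * y ^+ 2 by rewrite mulr_ge0// (N0.2).
have k0 : 0 <= k := le_trans p0 pkI.
have h5 : 0 <= k * x ^+ 2 by rewrite mulr_ge0// (N0.1).
rewrite /N in u l *; case: N0 => ? ?; split; lra.
Qed.

End lyapunov.

(** Young's inequality splits the mixed term: half of [eps * m ^ 2 * y ^ 2]
    survives, and the coefficient of [x ^ 2] is lowered by a multiple of [eps],
    which keeps half of [c] when [eps] is small. *)
Lemma cross_weight_exists (R : realType) (c m a1 a2 al p : R) :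
  0 < c -> 0 < m -> 0 <= a1 -> 0 <= al -> 0 < p ->
  exists eps r, [/\ 0 < eps, 0 < r, eps * al <= p &
    forall x y : R, - (c - eps * a1) * x ^+ 2 + eps * a2 * (x * y)
      - eps * m ^+ 2 * y ^+ 2 <= - (r * (x ^+ 2 + y ^+ 2))].
Proof.
move=> c0 m0 a10 al0 p0.
have m20 : 0 < m ^+ 2 by rewrite exprn_gt0.
pose D := a1 + a2 ^+ 2 / (2 * m ^+ 2) + 1.
have D0 : 0 < D.
  by rewrite ltr_wpDl// addr_ge0// divr_ge0 ?sqr_ge0// mulr_ge0// ltW.
pose eps := Num.min (c / (2 * D)) (p / (al + 1)).
have al1 : 0 < al + 1 by rewrite ltr_wpDl.
have eps0 : 0 < eps by rewrite lt_min !divr_gt0// mulr_gt0.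
have epsD : eps * (2 * D) <= c by rewrite -ler_pdivlMr ?mulr_gt0// ge_min lexx.
have epsal : eps * (al + 1) <= p by rewrite -ler_pdivlMr// ge_min lexx orbT.
exists eps, (Num.min (c / 2) (eps * m ^+ 2 / 2)); split=> //.
- by rewrite lt_min !divr_gt0// mulr_gt0.
- by apply: le_trans epsal; rewrite ler_wpM2l ?(ltW eps0)// lerDl.
move=> x y; set r := Num.min _ _.
have rc : r <= c / 2 by rewrite ge_min lexx.
have rm : r <= eps * m ^+ 2 / 2 by rewrite ge_min lexx orbT.
have rx : r * x ^+ 2 <= c / 2 * x ^+ 2 by rewrite ler_wpM2r// sqr_ge0.
have ry : r * y ^+ 2 <= eps * m ^+ 2 / 2 * y ^+ 2 by rewrite ler_wpM2r// sqr_ge0.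
have young : a2 * (x * y) <= a2 ^+ 2 / (2 * m ^+ 2) * x ^+ 2 + m ^+ 2 / 2 * y ^+ 2.
  rewrite -subr_ge0.
  have -> : a2 ^+ 2 / (2 * m ^+ 2) * x ^+ 2 + m ^+ 2 / 2 * y ^+ 2 - a2 * (x * y)
      = (a2 / m * x - m * y) ^+ 2 / 2 by field; rewrite gt_eqF.
  by rewrite divr_ge0 ?sqr_ge0.
have young' := ler_wpM2l (ltW eps0) young.
have hD : eps * (2 * D) * x ^+ 2 <= c * x ^+ 2 by rewrite ler_wpM2r// sqr_ge0.
have hx : 0 <= eps * x ^+ 2 by rewrite mulr_ge0 ?sqr_ge0// ltW.
rewrite /D in hD.
set z := a2 ^+ 2 / _ in young' hD; lra.
Qed.

(** * The observer error *)

(** Turns decay of an energy comparable to [x ^ 2 + y ^ 2] into decay of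
    [x + y] at half the rate: the energy decays like [d ^ 2]. *)
Lemma add_le_of_energy (R : realType) (p Q d x y x0 y0 W W0 : R) :
  0 < p -> 0 < Q -> 0 <= d -> 0 <= x0 -> 0 <= y0 ->
  p / 2 * (x ^+ 2 + y ^+ 2) <= W -> W0 <= Q * (x0 ^+ 2 + y0 ^+ 2) ->
  W <= W0 * d ^+ 2 ->
  x + y <= Num.sqrt (4 * Q / p) * (x0 + y0) * d.
Proof.
move=> p0 Q0 d0 x00 y00 pW WQ Wd.
have rhs0 : 0 <= Num.sqrt (4 * Q / p) * (x0 + y0) * d.
  by rewrite !mulr_ge0 ?sqrtr_ge0 ?addr_ge0.
apply: le_trans (ler_norm _) _.
rewrite -ler_sqr ?nnegrE// real_normK ?num_real// !exprMn sqr_sqrtr; last first.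
  by rewrite divr_ge0 ?mulr_ge0// ltW.
have step1 : (x + y) ^+ 2 <= 2 * (x ^+ 2 + y ^+ 2).
  by have := sqr_ge0 (x - y); lra.
have step2 : p / 2 * (x ^+ 2 + y ^+ 2) <= Q * (x0 + y0) ^+ 2 * d ^+ 2.
  apply: le_trans pW _; apply: le_trans Wd _; rewrite ler_wpM2r ?sqr_ge0//.
  apply: le_trans WQ _; rewrite ler_wpM2l ?(ltW Q0)//.
  by have := mulr_ge0 x00 y00; lra.
apply: le_trans step1 _.
have -> : 4 * Q / p * (x0 + y0) ^+ 2 * d ^+ 2
    = (4 / p) * (Q * (x0 + y0) ^+ 2 * d ^+ 2) by field; rewrite gt_eqF.
have -> : 2 * (x ^+ 2 + y ^+ 2) = (4 / p) * (p / 2 * (x ^+ 2 + y ^+ 2)).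
  by field; rewrite gt_eqF.
by rewrite ler_wpM2l// divr_ge0// ltW.
Qed.

(** The constants depend on [F], [L] and [U] only, so along the trajectory they
    are uniform in time. *)
Lemma sigma_bounds_mulmx (R : realType) (n : nat) (F g X : 'M[R]_n) (L U : R) :
  (0 < n)%N -> F \in unitmx -> 0 <= L -> L <= sigma_min g -> sigma_max g <= U ->
  L / (frob_norm (invmx F) + 1) * frob_norm X <= frob_norm ((F *m g) *m X) /\
  frob_norm (F *m g) <= frob_norm F * (U * frob_norm (1%:M : 'M[R]_n)).
Proof.
move=> n0 Fu L0 Lg gU; split; last first.
  apply: le_trans (frob_normM _ _) _; rewrite ler_wpM2l ?frob_norm_ge0//.
  have := sigma_max_mulmx g 1%:M n0; rewrite mulmx1 => /le_trans; apply.
  by rewrite ler_wpM2r ?frob_norm_ge0.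
have f0 : 0 < frob_norm (invmx F) + 1 by rewrite ltr_wpDl ?frob_norm_ge0.
rewrite mulrAC ler_pdivrMr// mulrC.
apply: (@le_trans _ _ (frob_norm (g *m X))).
  rewrite mulrC; apply: le_trans (sigma_min_mulmx X n0 (le_trans L0 Lg)).
  by rewrite ler_wpM2r ?frob_norm_ge0.
rewrite -mulmxA -{1}(mulKmx Fu (g *m X)) mulrC.
apply: le_trans (frob_normM _ _) _.
by rewrite ler_wpM2r ?frob_norm_ge0// lerDl.
Qed.

(** Substituting [Abar = M - E] and [bbar = b - e] in the observer, where the
    estimate [bbar] survives only through [M e]. The curve [M = F g] agrees with
    [A] at nonnegative times and inherits its derivative directly from [g]. *)
Lemma observer_error_derive (R : realType) (n : nat) (G : set 'M[R]_n)
    (g xi : R -> 'M[R]_n) (F : 'M[R]_n) (A : R -> 'M[R]_n) (b : 'M[R]_n)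
    (xim Abar bbar : R -> 'M[R]_n) (kP kI : R)
    (M := fun s => F *m g s) (E := fun s => M s - Abar s)
    (e := fun s => b - bbar s) (t : R) :
  group_trajectory G g xi -> (forall s : R, 0 <= s -> A s = F *m g s) ->
  (forall s : R, 0 <= s -> xim s = xi s + b) ->
  observer_solution G kP kI A xim Abar bbar -> 0 < t ->
  [/\ is_derive t 1 M (M t *m xi t),
      is_derive t 1 E (E t *m xim t - M t *m e t - kP *: E t) &
      is_derive t 1 e (kI *: orth_proj (lie_algebra G) ((M t)^T *m E t))].
Proof.
move=> [_ [gd _]] hA hxim [_ [Ad _] [bd _]] t0.
have Md : is_derive t 1 M (M t *m xi t).
  by rewrite /M -mulmxA; apply: is_derive_mulmxl; exact: gd.
split=> //.
  apply: (is_derive_eq (is_deriveB Md (Ad t t0))).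
  rewrite /E /e (hA _ (ltW t0)) (hxim _ (ltW t0)) -/(M t).
  rewrite mulmxBr !mulmxBl !mulmxDr scalerBr.
  rewrite !opprB !opprD !opprK !addrA.
  by apply/matrixP => i j; rewrite !mxE; ring.
apply: (is_derive_eq (is_deriveB (is_derive_cst b t 1) (bd t t0))).
by rewrite sub0r opprK (hA _ (ltW t0)).
Qed.

Theorem mainTheorem2 (R : realType) (n : nat) (hn : (0 < n)%N)
    (G : set 'M[R]_n) (hG : matrix_lie_group G)
    (g xi : R -> 'M[R]_n) (hg : group_trajectory G g xi)
    (F : 'M[R]_n) (hF : F \in unitmx)
    (A : R -> 'M[R]_n) (hA : forall t : R, 0 <= t -> A t = F *m g t)
    (b : 'M[R]_n) (hb : lie_algebra G b)
    (xim : R -> 'M[R]_n) (hxim : forall t : R, 0 <= t -> xim t = xi t + b)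
    (Bxi Bb : R) (hBxi : 0 < Bxi) (hBb : 0 < Bb)
    (hxi_bound : forall t : R, 0 <= t -> frob_norm (xi t) <= Bxi)
    (hb_bound : frob_norm b <= Bb)
    (Lg Ug : R) (hLg : 0 < Lg) (hUg : 0 < Ug)
    (hg_bound : forall t : R, 0 <= t ->
       [/\ Lg <= sigma_min (g t), sigma_min (g t) <= sigma_max (g t) &
           sigma_max (g t) <= Ug])
    (kP kI : R) (hkP : Bxi + Bb < kP) (hkI : 0 < kI) :
  exists a C : R, [/\ 0 < a, 0 < C &
    forall Abar bbar : R -> 'M[R]_n,
      observer_solution G kP kI A xim Abar bbar ->
      let Eg := fun t : R => g t - invmx F *m Abar t in
      let eb := fun t : R => b - bbar t in
      forall t : R, 0 <= t ->
        frob_norm (Eg t) + frob_norm (eb t) <=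
          C * (frob_norm (Eg 0) + frob_norm (eb 0)) * expR (- (a * t))].
Proof.
have Sub := lie_algebra_subspace hG.
have [_ hgd] := hg.
(* f1 and f2 exceed the norms of F and its inverse by 1, which makes them
   positive and lets them also absorb the unchanged term |eb|. *)
pose f1 := frob_norm F + 1; pose f2 := frob_norm (invmx F) + 1.
have f10 : 0 < f1 by rewrite ltr_wpDl ?frob_norm_ge0.
have f20 : 0 < f2 by rewrite ltr_wpDl ?frob_norm_ge0.
have f21 : 1 <= f2 by rewrite lerDr frob_norm_ge0.
have f11 : 1 <= f1 by rewrite lerDr frob_norm_ge0.
pose al := frob_norm F * (Ug * frob_norm (1%:M : 'M[R]_n)).
have al0 : 0 <= al by rewrite !mulr_ge0 ?frob_norm_ge0// ltW.
pose m := Lg / f2.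
have m0 : 0 < m by rewrite divr_gt0.
have M_bounds t X : 0 <= t ->
    m * frob_norm X <= frob_norm (F *m g t *m X) /\ frob_norm (F *m g t) <= al.
  move=> /hg_bound[h1 _ h2].
  exact: (sigma_bounds_mulmx X hn hF (ltW hLg) h1 h2).
pose K := Bxi + Bb; pose p := Num.min (2^-1) (2 * kI)^-1.
have p0 : 0 < p by rewrite lt_min !invr_gt0 mulr_gt0// ltr0n.
have [||eps [r [eps0 r0 epsal rate]]] := @cross_weight_exists R (kP - K) m
    (kI * al ^+ 2) (al * (K + kP + Bxi)) al p _ m0 _ al0 p0.
- by rewrite subr_gt0.
- by rewrite mulr_ge0 ?sqr_ge0// ltW.
pose Q := 2^-1 + (2 * kI)^-1 + p.
have Q0 : 0 < Q by rewrite !addr_gt0 ?invr_gt0 ?mulr_gt0.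
pose C1 := Num.sqrt (4 * Q / p).
have C10 : 0 < C1 by rewrite sqrtr_gt0 divr_gt0// mulr_gt0.
(* The Lyapunov function decays at rate r / Q, the norms at half of it; f2 and
   f1 convert between Eg and E at times t and 0. *)
exists (r / Q / 2), (f2 * C1 * f1); split.
- by rewrite !divr_gt0.
- by rewrite !mulr_gt0.
move=> Abar bbar obs Eg eb t t0.
have [bbarS Abard bbard] := obs.
pose M s := F *m g s; pose E s := M s - Abar s.
pose W s := lyapunov kI eps (M s) (E s) (eb s).
pose P s := orth_proj (lie_algebra G) ((M s)^T *m E s).
pose dW s := lyapunov_dot kI eps (M s) (M s *m xi s) (E s)
  (E s *m xim s - M s *m eb s - kP *: E s) (eb s) (kI *: P s).
have W_bounds s : 0 <= s ->
    p / 2 * (frob_norm (E s) ^+ 2 + frob_norm (eb s) ^+ 2) <= W s /\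
    W s <= Q * (frob_norm (E s) ^+ 2 + frob_norm (eb s) ^+ 2).
  move=> s0; apply: (lyapunov_bounds _ _ hkI (ltW eps0) (M_bounds s 0 s0).2) => //.
    by rewrite ge_min lexx.
  by rewrite ge_min lexx orbT.
have ebS s : 0 <= s -> lie_algebra G (eb s).
  case: Sub => _ SD SZ s0; apply: SD => //; rewrite -scaleN1r.
  by apply: SZ; exact: bbarS.
have dW_le s : 0 < s -> dW s <= - (r / Q * W s).
  move=> /ltW s0; have [M1 M2] := M_bounds s (eb s) s0.
  have [PS Pe] := orth_projP ((M s)^T *m E s) Sub.
  have xmK : frob_norm (xim s) <= K.
    by rewrite hxim// (le_trans (frob_normD _ _))// lerD// hxi_bound.
  have kP0 : 0 <= kP by rewrite ltW// (lt_trans _ hkP)// addr_gt0.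
  apply: le_trans (lyapunov_dot_le hkI kP0 (ltW eps0) al0 (ltW m0) xmK
    (hxi_bound s s0) M2 M1 (Pe _ (ebS s s0)) (frob_norm_orth_proj _ Sub)) _.
  apply: le_trans (rate _ _) _; rewrite lerN2 mulrAC ler_pdivrMr// -mulrA.
  by rewrite ler_wpM2l ?(ltW r0)// mulrC (W_bounds s s0).2.
have gc := is_derive_ge0_right_continuous0 hgd.
have Mc : right_continuous0 M.
  exact: (@right_continuous0_mulmx _ _ (cst F) g (@right_continuous0_cst _ _ F) gc).
have Ec : right_continuous0 E.
  exact: right_continuous0B Mc (is_derive_ge0_right_continuous0 Abard).
have ec : right_continuous0 eb.
  exact: (@right_continuous0B _ _ (cst b) bbar (@right_continuous0_cst _ _ b))
    (is_derive_ge0_right_continuous0 bbard).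
have W0 : W @ 0^'+ --> W 0.
  apply: cvgD; first apply: cvgD.
  - by apply: cvgM; [exact: cvg_cst|exact: right_continuous0_frob_inner].
  - by apply: cvgM; [exact: cvg_cst|exact: right_continuous0_frob_inner].
  - apply: cvgM; first exact: cvg_cst.
    exact: right_continuous0_frob_inner (right_continuous0_mulmx Mc ec).
have Wd (s : R) : 0 < s -> is_derive s 1 W (dW s).
  move=> /(observer_error_derive hg hA hxim obs)[d1 d2 d3].
  exact: is_derive_lyapunov d1 d2 d3.
have Wt := exp_decay W0 Wd dW_le t0.
have sum_le : frob_norm (E t) + frob_norm (eb t) <=
    C1 * (frob_norm (E 0) + frob_norm (eb 0)) * expR (- (r / Q / 2 * t)).
  apply: (add_le_of_energy p0 Q0 _ _ _ (W_bounds t t0).1 (W_bounds 0 (lexx 0)).2).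
  - exact: expR_ge0.
  - exact: frob_norm_ge0.
  - exact: frob_norm_ge0.
  - rewrite expr2 -expRD; apply: le_trans Wt _.
    rewrite le_eqVlt; apply/orP; left; apply/eqP; congr (_ * expR _); lra.
have EgE s : Eg s = invmx F *m E s by rewrite mulmxBr mulKmx.
have EEg s : E s = F *m Eg s by rewrite EgE mulKVmx.
have hEgt : frob_norm (Eg t) + frob_norm (eb t) <=
    f2 * (frob_norm (E t) + frob_norm (eb t)).
  rewrite mulrDr lerD//; last by rewrite ler_peMl ?frob_norm_ge0.
  rewrite EgE (le_trans (frob_normM _ _))// ler_wpM2r ?frob_norm_ge0//.
  by rewrite lerDl.
have hE0 : frob_norm (E 0) + frob_norm (eb 0) <=
    f1 * (frob_norm (Eg 0) + frob_norm (eb 0)).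
  rewrite mulrDr lerD//; last by rewrite ler_peMl ?frob_norm_ge0.
  rewrite EEg (le_trans (frob_normM _ _))// ler_wpM2r ?frob_norm_ge0//.
  by rewrite lerDl.
apply: le_trans hEgt _; rewrite -!mulrA ler_wpM2l ?(ltW f20)//.
apply: le_trans sum_le _; rewrite -!mulrA ler_wpM2l ?(ltW C10)//.
by rewrite [leRHS]mulrA ler_wpM2r ?expR_ge0.
Qed.
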